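(* Let $\gamma\in(0,1)$ denote the discount factor of the underlying discounted Markov decision process. Assume $|\mathcal S|\ge2$ and $\min_{s\in\mathcal S}|\mathcal A_s|\neq|\mathcal A|$. If $$\underline\pi\le\frac{(1-\gamma)\min_{s\in\mathcal S}\nu(s)}{(|\mathcal A|-\min_{s\in\mathcal S}|\mathcal A_s|)\,(8+(1-\gamma)\min_{s\in\mathcal S}\nu(s))}$$ and the perturbed policy $\widetilde\pi$ is constructed from $\underline\pi$, then $$\inf_{x\in\mathbb S,\ \|x\|_{\widetilde D}=1}x^\top\widetilde D(I-\gamma P)x\ \ge\ \tfrac34(1-\gamma).$$
   Context: Finite MDP with state space $\mathcal S$, action space $\mathcal A$, transition kernel $\mathsf P(s'|s,a)$; for every policy the induced state chain $P_\pi(s,s')=\sum_a\pi(a|s)\mathsf P(s'|s,a)$ is irreducible and aperiodic. Fix a policy $\pi$ (entries may be zero) with stationary state distribution $\nu>0$ of $P_\pi$. $P((s,a),(s',a'))=\mathsf P(s'|s,a)\pi(a'|s')$. $\mathbb S$ is a linear subspace of $\mathbb R^{|\mathcal S||\mathcal A|}$ spanned by $d$ linearly independent feature vectors. $\|x\|_{\widetilde D}=\sqrt{x^\top\widetilde Dx}$. **Perturbed policy.** For a constant $0<\underline\pi<1$ let $\mathcal A_s:=\{a\in\mathcal A:\pi(a|s)>\underline\pi/2\}$ and $$\widetilde\pi(a|s):=\begin{cases}\underline\pi,&a\notin\mathcal A_s\\ \pi(a|s)\cdot\frac{1-(|\mathcal A|-|\mathcal A_s|)\underline\pi}{\sum_{a'\in\mathcal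 A_s}\pi(a'|s)},&a\in\mathcal A_s.\end{cases}$$ $\widetilde D:=\mathrm{diag}(\nu(s)\widetilde\pi(a|s))$. *)

(* Defs.v *)
From HB Require Import structures.
From mathcomp Require Import all_boot all_order all_algebra.
From mathcomp Require Import boolp classical_sets reals ereal.

Set Implicit Arguments.
Unset Strict Implicit.
Unset Printing Implicit Defensive.

Import Order.TTheory GRing.Theory Num.Theory.
Local Open Scope ring_scope.

(* Vectors and matrices indexed by a finite type T are coordinatised by the
   enumeration [enum_val : 'I_#|T| -> T]. *)
Definition mx_of (R : realType) (T : finType) (f : T -> T -> R) : 'M[R]_#|T| :=
  \matrix_(i, j) f (enum_val i) (enum_val j).

Definition diag_of (R : realType) (T : finType) (f : T -> R) : 'M[R]_#|T| :=
  diag_mx (\row_i f (enum_val i)).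

Definition qform (R : realType) (n : nat) (M : 'M[R]_n) (x : 'cV[R]_n) : R :=
  (x^T *m M *m x) 0 0.

Definition wnorm (R : realType) (n : nat) (M : 'M[R]_n) (x : 'cV[R]_n) : R :=
  Num.sqrt (qform M x).

Definition is_pmf (R : realType) (T : finType) (f : T -> R) : Prop :=
  (forall t, 0 <= f t) /\ \sum_t f t = 1.

Definition irreducible_chain (R : realType) (n : nat) (Q : 'M[R]_n) : Prop :=
  forall i j, exists k : nat, 0 < (Q ^+ k) i j.

(* The gcd of the set of positive return times to each state is 1. *)
Definition aperiodic_chain (R : realType) (n : nat) (Q : 'M[R]_n) : Prop :=
  forall (i : 'I_n) (d : nat),
    (forall k : nat, (0 < k)%N -> 0 < (Q ^+ k) i i -> (d %| k)%N) -> d = 1%N.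

Definition is_stationary (R : realType) (T : finType) (Q : T -> T -> R)
    (nu : T -> R) : Prop :=
  is_pmf nu /\ forall t, \sum_s nu s * Q s t = nu t.

Section MDP.
Variables (R : realType) (S A : finType).

(* [p s a s'] is the probability of moving to s' from s under action a. *)
Definition is_kernel (p : S -> A -> S -> R) : Prop :=
  forall s a, is_pmf (p s a).

(* [pi s a] is the probability of choosing a in state s. *)
Definition is_policy (pi : S -> A -> R) : Prop := forall s, is_pmf (pi s).

Definition state_chain (p : S -> A -> S -> R) (pi : S -> A -> R) (s s' : S) : R :=
  \sum_a pi s a * p s a s'.

Definition sa_chain (p : S -> A -> S -> R) (pi : S -> A -> R) (z z' : S * A) : R :=
  p z.1 z.2 z'.1 * pi z'.1 z'.2.

Definition ergodic_mdp (p : S -> A -> S -> R) : Prop :=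
  forall pi, is_policy pi ->
    irreducible_chain (mx_of (state_chain p pi)) /\
    aperiodic_chain (mx_of (state_chain p pi)).

Definition likely_actions (pi : S -> A -> R) (u : R) (s : S) : {set A} :=
  [set a | u / 2 < pi s a].

Definition perturbed_policy (pi : S -> A -> R) (u : R) (s : S) (a : A) : R :=
  let As := likely_actions pi u s in
  if a \in As then
    pi s a * ((1 - (#|A|%:R - #|As|%:R) * u) / \sum_(a' in As) pi s a')
  else u.

Definition sa_weight (nu : S -> R) (pi : S -> A -> R) (z : S * A) : R :=
  nu z.1 * pi z.1 z.2.

(* The two minima below start from an upper bound of the values (#|As| <= #|A|,
   and nu s <= 1 for a probability mass function), so the default value is
   immaterial as soon as S is nonempty. *)
Definition min_likely (pi : S -> A -> R) (u : R) : nat :=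
  \big[minn/#|A|]_s #|likely_actions pi u s|.

Definition min_prob (nu : S -> R) : R := \big[Num.min/1]_s nu s.

End MDP.

(* Main.v *)
Require Import Defs.
From HB Require Import structures.
From mathcomp Require Import all_boot all_order all_algebra.
From mathcomp Require Import boolp classical_sets reals ereal.
From mathcomp Require Import ring lra.

Set Implicit Arguments.
Unset Strict Implicit.
Unset Printing Implicit Defensive.

Import Order.TTheory GRing.Theory Num.Theory.
Local Open Scope ring_scope.
Local Open Scope classical_set_scope.

(* With w the weights of the diagonal of Dt, AM-GM bounds <x, P x>_w by the mean
   of |x|_w^2 and |x|_(w P)^2, so it is enough to show w P <= (1 + c) w
   entrywise with c = (1 - gamma) / 4.  Write K u for the largest mass that the
   perturbation can assign to unlikely actions.  Likely actions only lose mass,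
   by a factor at least 1 - K u, and so one step from w has a state marginal of
   at most nu + K u <= (1 + K u / min nu) nu; the hypothesis on u makes
   (1 + K u / min nu) / (1 - K u) at most 1 + c. *)

(** * Quadratic forms with diagonal weights *)

Lemma sum_enum_val (R : realType) (T : finType) (F : T -> R) :
  \sum_(i < #|T|) F (enum_val i) = \sum_t F t.
Proof. by rewrite -big_enum_val; apply: eq_bigl => t; rewrite inE. Qed.

Lemma qform_diag_mul (R : realType) (T : finType) (w : T -> R)
    (M : 'M[R]_#|T|) (x : 'cV[R]_#|T|) :
  qform (diag_of w *m M) x =
  \sum_t w t * x (enum_rank t) 0 *
    \sum_t' M (enum_rank t) (enum_rank t') * x (enum_rank t') 0.
Proof.
rewrite /qform /diag_of -!mulmxA mxE -[RHS]sum_enum_val.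
apply: eq_bigr => i _; rewrite mul_diag_mx !mxE enum_valK mulrA.
rewrite [x i 0 * _]mulrC; congr (_ * _); rewrite -[RHS]sum_enum_val.
by apply: eq_bigr => j _; rewrite enum_valK.
Qed.

Lemma qform_diag (R : realType) (T : finType) (w : T -> R) (x : 'cV[R]_#|T|) :
  qform (diag_of w) x = \sum_t w t * x (enum_rank t) 0 ^+ 2.
Proof.
rewrite -[diag_of w]mulmx1 qform_diag_mul; apply: eq_bigr => t _.
rewrite (bigD1 t) //= mxE eqxx mul1r big1 ?addr0 ?expr2 ?mulrA // => t' nt.
by rewrite mxE (inj_eq enum_rank_inj) eq_sym (negPf nt) mul0r.
Qed.

Lemma qform_discounted (R : realType) (T : finType) (w : T -> R)
    (Q : T -> T -> R) (gamma : R) (x : 'cV[R]_#|T|) :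
  qform (diag_of w *m (1%:M - gamma *: mx_of Q)) x =
  qform (diag_of w) x -
  gamma * \sum_t \sum_t' w t * Q t t' *
            (x (enum_rank t) 0 * x (enum_rank t') 0).
Proof.
have -> : qform (diag_of w) x = qform (diag_of w *m 1%:M) x by rewrite mulmx1.
rewrite !qform_diag_mul mulr_sumr -sumrB; apply: eq_bigr => t _.
rewrite !mulr_sumr -sumrB; apply: eq_bigr => t' _.
by rewrite !mxE !enum_rankK; ring.
Qed.

(** AM-GM splits the cross term into two halves. Row sums equal to 1 turn the first into half of the
    weighted square norm; the column bound [wQ] makes the second at most [(1 + c) / 2] times it,
    hence the factor [1 + c / 2]. *)
Lemma le_qform_discounted (R : realType) (T : finType) (w : T -> R)
    (Q : T -> T -> R) (gamma c : R) (x : 'cV[R]_#|T|) :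
  (forall t, 0 <= w t) -> (forall t, is_pmf (Q t)) -> 0 <= gamma ->
  (forall t', \sum_t w t * Q t t' <= (1 + c) * w t') ->
  (1 - gamma * (1 + c / 2)) * qform (diag_of w) x <=
    qform (diag_of w *m (1%:M - gamma *: mx_of Q)) x.
Proof.
move=> w_ge0 pmfQ gamma_ge0 wQ.
rewrite qform_discounted mulrBl mul1r lerD2l lerN2 -mulrA ler_wpM2l //.
rewrite qform_diag.
set f := fun t => x (enum_rank t) 0; rewrite -/(f _).
have amgm : \sum_t \sum_t' w t * Q t t' * (f t * f t') <=
    \sum_t \sum_t' (w t * Q t t' * f t ^+ 2 / 2 + w t * Q t t' * f t' ^+ 2 / 2).
  apply: ler_sum => t _; apply: ler_sum => t' _.
  have wQ_ge0 : 0 <= w t * Q t t' by rewrite mulr_ge0 ?(pmfQ t).1.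
  have := mulr_ge0 wQ_ge0 (sqr_ge0 (f t - f t')); lra.
apply: (le_trans amgm).
under eq_bigr => t _ do rewrite big_split /=.
(* Only the second half is summed over [t] first, so that the columns of [w t * Q t t'] appear. *)
rewrite big_split /= [X in _ + X]exchange_big /=.
have -> : \sum_t \sum_t' w t * Q t t' * f t ^+ 2 / 2 =
    \sum_t w t * f t ^+ 2 / 2.
  apply: eq_bigr => t _; rewrite -!mulr_suml -mulr_sumr.
  by rewrite (pmfQ t).2 mulr1.
rewrite -big_split mulr_sumr /=; apply: ler_sum => t _.
rewrite -!mulr_suml -/(f t).
have := ler_wpM2r (sqr_ge0 (f t)) (wQ t); nra.
Qed.

(** * Minima, and one step of the state-action chain *)

Lemma pmf_le1 (R : realType) (T : finType) (f : T -> R) t : is_pmf f -> f t <= 1.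
Proof. by case=> f_ge0 <-; rewrite (bigD1 t) //= lerDl; apply: sumr_ge0. Qed.

Lemma min_likely_le (R : realType) (S A : finType) (pi : S -> A -> R) (u : R) s :
  (min_likely pi u <= #|likely_actions pi u s|)%N.
Proof. by rewrite /min_likely -minEnat -leEnat bigmin_le. Qed.

Lemma min_likely_le_card (R : realType) (S A : finType) (pi : S -> A -> R)
    (u : R) : (min_likely pi u <= #|A|)%N.
Proof. by rewrite /min_likely -minEnat -leEnat bigmin_le_id. Qed.

Lemma min_prob_le (R : realType) (S : finType) (nu : S -> R) s :
  min_prob nu <= nu s.
Proof. exact: bigmin_le. Qed.

Lemma min_prob_gt0 (R : realType) (S : finType) (nu : S -> R) :
  (forall s, 0 < nu s) -> 0 < min_prob nu.
Proof. by move=> nu_gt0; apply/bigmin_gtP; split. Qed.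

Lemma sa_chain_pmf (R : realType) (S A : finType) (p : S -> A -> S -> R)
    (pi : S -> A -> R) z :
  is_kernel p -> is_policy pi -> is_pmf (sa_chain p pi z).
Proof.
move=> hp hpi; split=> [z'|].
  by rewrite mulr_ge0 ?(hp _ _).1 ?(hpi _).1.
rewrite -(pair_bigA _ (fun s a => p z.1 z.2 s * pi s a)) /=.
rewrite -(hp z.1 z.2).2; apply: eq_bigr => s _.
by rewrite -mulr_sumr (hpi s).2 mulr1.
Qed.

(** The next action is drawn from [pi] whatever [rho] was, so [rho] enters only through the state
    marginal. *)
Lemma sum_sa_chain (R : realType) (S A : finType) (p : S -> A -> S -> R)
    (nu : S -> R) (pi rho : S -> A -> R) z' :
  \sum_z sa_weight nu rho z * sa_chain p pi z z' =
  (\sum_s nu s * state_chain p rho s z'.1) * pi z'.1 z'.2.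
Proof.
rewrite -(pair_bigA _ (fun s a =>
  nu s * rho s a * (p s a z'.1 * pi z'.1 z'.2))) /= mulr_suml.
apply: eq_bigr => s _; rewrite mulr_sumr mulr_suml.
by apply: eq_bigr => a _; ring.
Qed.

(** * Comparison of the perturbed policy with [pi] *)

Section PerturbedPolicy.
Variables (R : realType) (S A : finType) (pi : S -> A -> R) (u : R).
Hypotheses (hpi : is_policy pi) (u_gt0 : 0 < u).

Let As s := likely_actions pi u s.
Let K : R := #|A|%:R - (min_likely pi u)%:R.
Hypothesis Ku_lt1 : K * u < 1.

Lemma card_unlikely s : #|A|%:R - #|As s|%:R = #|~: As s|%:R :> R.
Proof. by rewrite -(cardsC (As s)) natrD addrAC subrr add0r. Qed.

Lemma card_unlikely_le s : #|~: As s|%:R <= K.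
Proof. by rewrite -card_unlikely lerD2l lerN2 ler_nat min_likely_le. Qed.

Lemma unlikely_mass_le s : #|~: As s|%:R * u <= K * u.
Proof. by rewrite ler_wpM2r ?card_unlikely_le ?ltW. Qed.

Lemma sum_likely_le1 s : \sum_(a in As s) pi s a <= 1.
Proof.
rewrite -(hpi s).2 [leRHS](bigID (mem (As s))) /= lerDl.
by apply: sumr_ge0 => a _; rewrite (hpi s).1.
Qed.

(** An unlikely action has probability at most [u / 2], hence at most [u]. This makes the rescaling
    factor of the likely actions at most 1. *)
Lemma sum_likely_ge s : 1 - #|~: As s|%:R * u <= \sum_(a in As s) pi s a.
Proof.
rewrite lerBlDr -[leLHS](hpi s).2 [leLHS](bigID (mem (As s))) /= lerD2l.
rewrite mulr_natl -sumr_const big_mkcond [leRHS]big_mkcond /=.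
apply: ler_sum => a _; rewrite finset.in_setC; case: ifP => // aAs.
have := aAs; rewrite inE -leNgt; have := u_gt0; lra.
Qed.

Lemma sum_likely_gt0 s : 0 < \sum_(a in As s) pi s a.
Proof.
apply: lt_le_trans (sum_likely_ge s); rewrite subr_gt0.
exact: le_lt_trans (unlikely_mass_le s) Ku_lt1.
Qed.

Lemma perturbed_policy_unlikely s a :
  a \notin As s -> perturbed_policy pi u s a = u.
Proof. by rewrite /perturbed_policy -/(As s) => /negPf ->. Qed.

Lemma perturbed_policy_likely_le s a :
  a \in As s -> perturbed_policy pi u s a <= pi s a.
Proof.
rewrite /perturbed_policy -/(As s) => -> /=; rewrite card_unlikely.
rewrite ler_piMr ?(hpi s).1 // ler_pdivrMr ?sum_likely_gt0 // mul1r.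
exact: sum_likely_ge.
Qed.

(** An unlikely action is raised from at most [u / 2] to [u]. A likely one is scaled by a quotient
    with numerator at least [1 - K * u] and denominator at most 1. *)
Lemma perturbed_policy_ge s a :
  (1 - K * u) * pi s a <= perturbed_policy pi u s a.
Proof.
have pi_ge0 := (hpi s).1 a.
have [aAs|aAs] := boolP (a \in As s); last first.
  rewrite perturbed_policy_unlikely //; move: aAs; rewrite inE -leNgt => pi_le.
  have := unlikely_mass_le s; have := u_gt0.
  have : 0 <= #|~: As s|%:R * u by rewrite mulr_ge0 ?ler0n ?ltW.
  nra.
rewrite /perturbed_policy -/(As s) aAs card_unlikely mulrC ler_wpM2l //.
rewrite ler_pdivlMr ?sum_likely_gt0 //.
have := unlikely_mass_le s; have := sum_likely_le1 s; have := Ku_lt1.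
have := sum_likely_gt0 s; nra.
Qed.

Lemma perturbed_policy_ge0 s a : 0 <= perturbed_policy pi u s a.
Proof.
apply: le_trans (perturbed_policy_ge s a).
by rewrite mulr_ge0 ?(hpi s).1 // subr_ge0 ltW.
Qed.

Variables (p : S -> A -> S -> R) (nu : S -> R).
Hypothesis hp : is_kernel p.

(** Likely actions contribute no more than under [pi], and each unlikely one at most [u]. *)
Lemma state_chain_perturbed_le s s' :
  state_chain p (perturbed_policy pi u) s s' <= state_chain p pi s s' + K * u.
Proof.
apply: (@le_trans _ _ (state_chain p pi s s' + #|~: As s|%:R * u)); last first.
  by rewrite lerD2l unlikely_mass_le.
rewrite mulr_natl -sumr_const big_mkcond /= -big_split /=.
apply: ler_sum => a _; rewrite finset.in_setC.
have p_ge0 := (hp s a).1 s'; have p_le1 := pmf_le1 s' (hp s a).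
have pi_ge0 := (hpi s).1 a; have := u_gt0.
case: ifPn => [aAs|/negPn aAs] uu; last first.
  by rewrite addr0 ler_wpM2r // perturbed_policy_likely_le.
rewrite perturbed_policy_unlikely //; nra.
Qed.

(** Averaging over [nu] reproduces [nu] by stationarity and keeps the error [K * u], as [nu] has
    total mass 1. *)
Lemma perturbed_marginal_le s' : is_stationary (state_chain p pi) nu ->
  \sum_s nu s * state_chain p (perturbed_policy pi u) s s' <= nu s' + K * u.
Proof.
case=> -[nu_ge0 nu_sum] nuP.
rewrite -(nuP s') -[K * u]mul1r -[X in X * _]nu_sum mulr_suml -big_split /=.
apply: ler_sum => s _; rewrite -mulrDr ler_wpM2l //.
exact: state_chain_perturbed_le.
Qed.

End PerturbedPolicy.

Theorem lemma21 (R : realType) (S A : finType)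
    (p : S -> A -> S -> R) (hp : is_kernel p) (hergodic : ergodic_mdp p)
    (pi : S -> A -> R) (hpi : is_policy pi)
    (nu : S -> R) (hnu : is_stationary (state_chain p pi) nu)
    (hnu_gt0 : forall s, 0 < nu s)
    (d : nat) (phi : d.-tuple 'cV[R]_#|{: S * A}|)
    (SS : {vspace 'cV[R]_#|{: S * A}|}) (hSS : basis_of SS phi)
    (gamma : R) (hgamma : 0 < gamma < 1)
    (hS : (2 <= #|S|)%N)
    (u : R) (hu : 0 < u < 1)
    (hmin : min_likely pi u <> #|A|)
    (hbound : u <= (1 - gamma) * min_prob nu /
       ((#|A|%:R - (min_likely pi u)%:R) * (8 + (1 - gamma) * min_prob nu))) :
  let P := mx_of (sa_chain p pi) in
  let Dt := diag_of (sa_weight nu (perturbed_policy pi u)) in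
  ((3 / 4 * (1 - gamma))%:E <=
    ereal_inf [set (qform (Dt *m (1%:M - gamma *: P)) x)%R%:E
              | x in [set x | x \in SS /\ (wnorm Dt x = 1)%R]])%E.
Proof.
cbv zeta; set P := mx_of _; set Dt := diag_of _.
have pi_ge0 s a := (hpi s).1 a.
case/andP: hgamma => gamma_gt0 gamma_lt1; case/andP: hu => u_gt0 u_lt1.
set K : R := #|A|%:R - (min_likely pi u)%:R in hbound.
set m := min_prob nu in hbound.
have m_gt0 : 0 < m by apply: min_prob_gt0.
(* [hmin] makes the denominator of [hbound] positive, so that it can be cleared. *)
have K_gt0 : 0 < K.
  by rewrite subr_gt0 ltr_nat ltn_neqAle min_likely_le_card andbT; apply/eqP.
have k_gt0 : 0 < (1 - gamma) * m by rewrite mulr_gt0 // subr_gt0.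
have Ku_ub : K * u * (8 + (1 - gamma) * m) <= (1 - gamma) * m.
  move: hbound; rewrite ler_pdivlMr; last by rewrite mulr_gt0 // addr_gt0.
  by rewrite mulrA [u * K]mulrC.
have Ku_gt0 : 0 < K * u by rewrite mulr_gt0.
have Ku_lt1 : K * u < 1.
  have k8_gt0 : 0 < 8 + (1 - gamma) * m by rewrite addr_gt0.
  rewrite -(ltr_pM2r k8_gt0).
  by apply: (le_lt_trans Ku_ub); rewrite mul1r ltrDr.
have K8u_le : 8 * (K * u) <= (1 - gamma) * m * (1 - K * u) by lra.
apply/ereal_infP => _ [x [_ x1] <-]; rewrite lee_fin.
(* [Num.sqrt] is 0 on negative numbers, so positivity is deduced from the norm before squaring. *)
have qx1 : qform Dt x = 1.
  have q_gt0 : 0 < qform Dt x by rewrite -sqrtr_gt0 -/(wnorm Dt x) x1.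
  by rewrite -(sqr_sqrtr (ltW q_gt0)) -/(wnorm Dt x) x1 expr1n.
have w_ge0 z : 0 <= sa_weight nu (perturbed_policy pi u) z.
  by rewrite mulr_ge0 ?perturbed_policy_ge0 // ltW.
have wP z' : \sum_z sa_weight nu (perturbed_policy pi u) z * sa_chain p pi z z'
    <= (1 + (1 - gamma) / 4) * sa_weight nu (perturbed_policy pi u) z'.
  rewrite sum_sa_chain.
  have marg := perturbed_marginal_le hpi u_gt0 Ku_lt1 hp z'.1 hnu.
  have low := perturbed_policy_ge hpi u_gt0 Ku_lt1 z'.1 z'.2.
  rewrite -/K in marg low.
  have m_le : m <= nu z'.1 := min_prob_le nu z'.1.
  apply: (le_trans (ler_wpM2r (pi_ge0 z'.1 z'.2) marg)).
  (* After expansion this asks for [nu * (K * u) + K * u <= (1 - gamma) / 4 * nu * (1 - K * u)]. The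
     left side is at most [2 * (K * u)] since [nu <= 1]; the right side is at least that by [K8u_le]
     and [m <= nu], which is where the 8 is used. *)
  have ratio : nu z'.1 + K * u <=
      (1 + (1 - gamma) / 4) * nu z'.1 * (1 - K * u).
    have : (1 - gamma) * m * (1 - K * u) <= (1 - gamma) * nu z'.1 * (1 - K * u).
      rewrite ler_wpM2r ?(subr_ge0, ltW Ku_lt1) //.
      by rewrite ler_wpM2l ?(subr_ge0, ltW gamma_lt1).
    have : nu z'.1 * (K * u) <= K * u.
      by rewrite ler_piMl ?(ltW Ku_gt0) ?(pmf_le1 _ hnu.1).
    lra.
  apply: (le_trans (ler_wpM2r (pi_ge0 z'.1 z'.2) ratio)).
  rewrite -[leLHS]mulrA /sa_weight [leRHS]mulrA ler_wpM2l //.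
  by rewrite mulr_ge0 ?(ltW (hnu_gt0 _)) ?addr_ge0 ?divr_ge0 // subr_ge0 ltW.
have := le_qform_discounted x w_ge0
  (fun z => sa_chain_pmf z hp hpi) (ltW gamma_gt0) wP.
rewrite -/Dt -/P qx1 mulr1; apply: le_trans.
(* With [c = (1 - gamma) / 4] the constant is [(1 - gamma) * (1 - gamma / 8)], and
   [gamma / 8 < 1 / 4]. *)
nra.
Qed.
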